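(* Let $2\leq p<\infty$ and $2\leq s<\infty$ be integers, let $\{2p\}$ denote the regular $2p$-gon, and let $\rho_0,\rho_1,\rho_2$ be the distinguished generators of the group $G(2^{\{2p\},\mathcal{G}(s)})$ of the regular polytope $2^{\{2p\},\mathcal{G}(s)}$. Then $G(2^{\{2p\},\mathcal{G}(s)})=[4,2p\mid 4^{p-2},2s]$, that is, it has the presentation $$G(2^{\{2p\},\mathcal{G}(s)})=\Big\langle \rho_0,\rho_1,\rho_2\ \Big|\ \rho_0^2=\rho_1^2=\rho_2^2=(\rho_0\rho_1)^4=(\rho_1\rho_2)^{2p}=(\rho_0\rho_2)^2=id,$$ $$(\rho_0\rho_1(\rho_2\rho_1)^{j-1})^4=id\ \text{ for } 2\leq j\leq p-1,\quad (\rho_0\rho_1(\rho_2\rho_1)^{p-1})^{2s}=id\Big\rangle.$$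
   Context: C-groups and polytopes: a C-group of rank $m$ is a group $G$ with generating involutions $\rho_0,\dots,\rho_{m-1}$ satisfying $\langle\rho_i\mid i\in I\rangle\cap\langle\rho_j\mid j\in J\rangle=\langle\rho_k\mid k\in I\cap J\rangle$ for all $I,J\subseteq\{0,\dots,m-1\}$; it is a string C-group if $(\rho_i\rho_j)^2=id$ whenever $|i-j|\geq 2$. Abstract regular polytopes $\mathcal{P}$ of rank $m$ are in one-to-one correspondence with string C-groups $G(\mathcal{P})$ of rank $m$ (the automorphism group with its distinguished generators): the $i$-faces are the right cosets of $\langle\rho_j\mid j\neq i\rangle$, and vertices are the $0$-faces. Construction of $2^{\mathcal{P},\mathcal{G}(s)}$: let $\mathcal{P}$ be a centrally symmetric regular $n$-polytope with group $G(\mathcal{P})=\langle\tau_0,\dots,\tau_{n-1}\rangle$, i.e. $G(\mathcal{P})$ has a proper central involution $\alpha$ fixing no vertex. Let $F_0$ be the base vertex, stabilized by $\langle\tau_1,\dots,\tau_{n-1}\rangle$. Let $W$ be the Coxeter group generated by involutions $\sigma_F$, one for each vertex $F$ of $\mathcal{P}$, with defining relations $\sigma_F^2=id$, $(\sigma_F\sigma_{F\alpha})^s=id$, and $(\sigma_F\sigma_{F'})^2=id$ for $F'\notin\{F,F\alpha\}$ (its Coxeter diagram is $\mathcal{G}(s)$). The group $G(\mathcal{P})$ acts on $W$ by $\tau^{-1}\sigma_F\tau=\sigma_{F\tau}$. Then $2^{\mathcal{P},\mathcal{G}(s)}$ is the regular $(n+1)$-polytope with group $G(2^{\mathcal{P},\mathcal{G}(s)}):=W\rtimes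 G(\mathcal{P})=\langle\rho_0,\dots,\rho_n\rangle$, where $\rho_0:=\sigma_{F_0}$ and $\rho_i:=\tau_{i-1}$ for $1\leq i\leq n$. For the $2p$-gon, $G(\{2p\})=\langle\tau_0,\tau_1\rangle$ is dihedral of order $4p$ and $\alpha=(\tau_0\tau_1)^p$. Notation: with $k:=\lfloor q/2\rfloor$, $[p,q\mid h_2,\dots,h_k]$ denotes the group with generators $\rho_0,\rho_1,\rho_2$ and defining relations $\rho_0^2=\rho_1^2=\rho_2^2=(\rho_0\rho_1)^p=(\rho_1\rho_2)^q=(\rho_0\rho_2)^2=id$ and $(\rho_0\rho_1(\rho_2\rho_1)^{j-1})^{h_j}=id$ for $2\leq j\leq k$; and $4^{p-2}$ means a row of $p-2$ fours. *)

(* Defs.v *)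
From HB Require Import structures.
From mathcomp Require Import all_boot all_algebra.
From mathcomp Require Import boolp classical_sets.
Set Implicit Arguments.
Unset Strict Implicit.
Unset Printing Implicit Defensive.

Import GRing.Theory.

Local Open Scope classical_set_scope.
Local Open Scope group_scope.
Local Open Scope quotient_scope.

(* The pair (i, false) stands for the letter x_i and (i, true) for x_i^-1. *)
Definition word (I : Type) := seq (I * bool).

Definition letter (I : Type) (i : I) : word I := [:: (i, false)].

Definition wpow (I : Type) (w : word I) (n : nat) : word I :=
  flatten (nseq n w).

Definition eval_letter (I : Type) (G : groupType) (x : I -> G) (a : I * bool)
  : G := if a.2 then (x a.1)^-1 else x a.1.

Definition eval_word (I : Type) (G : groupType) (x : I -> G) (w : word I) : G :=
  foldr (fun a g => eval_letter x a * g) 1 w.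

(* Equality in < x_i (i : I) | r = 1 (r in R) >: the congruence on words
   generated by free cancellation and the relators. *)
Inductive word_eq (I : Type) (R : set (word I)) : word I -> word I -> Prop :=
| Weq_refl u : word_eq R u u
| Weq_sym u v : word_eq R u v -> word_eq R v u
| Weq_trans u v w : word_eq R u v -> word_eq R v w -> word_eq R u w
| Weq_cat u u' v v' :
    word_eq R u u' -> word_eq R v v' -> word_eq R (u ++ v) (u' ++ v')
| Weq_cancel i b : word_eq R [:: (i, b); (i, ~~ b)] [::]
| Weq_relator r : R r -> word_eq R r [::].

Section Presented.
Variables (I : choiceType) (R : set (word I)).

Definition word_eqb (u v : word I) : bool := `[< word_eq R u v >].

Lemma word_eqb_refl : reflexive word_eqb.
Proof. by move=> u; apply/asboolP; apply: Weq_refl. Qed.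

Lemma word_eqb_sym : symmetric word_eqb.
Proof. by move=> u v; apply/asboolP/asboolP; apply: Weq_sym. Qed.

Lemma word_eqb_trans : transitive word_eqb.
Proof.
by move=> v u w /asboolP uv /asboolP vw; apply/asboolP; apply: Weq_trans uv vw.
Qed.

Canonical word_equiv :=
  EquivRel word_eqb word_eqb_refl word_eqb_sym word_eqb_trans.

Definition presented := {eq_quot word_equiv}.
HB.instance Definition _ := EqQuotient.on presented.
HB.instance Definition _ := Choice.on presented.

Lemma presentedP (u v : word I) : word_eq R u v <-> \pi_presented u = \pi_presented v.
Proof.
split=> [uv|/eqquotP/asboolP //].
by apply/eqquotP/asboolP.
Qed.

Definition pres_one : presented := \pi_presented [::].
Definition pres_mul (x y : presented) : presented := \pi_presented (repr x ++ repr y).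
Definition winv (w : word I) : word I := rev [seq (a.1, ~~ a.2) | a <- w].
Definition pres_inv (x : presented) : presented := \pi_presented (winv (repr x)).

Lemma repr_word_eq w : word_eq R (repr (\pi_presented w)) w.
Proof. by apply/presentedP; rewrite reprK. Qed.

Lemma pres_mulE u v : pres_mul (\pi_presented u) (\pi_presented v) = \pi_presented (u ++ v).
Proof. by apply/presentedP; apply: Weq_cat; apply: repr_word_eq. Qed.

Lemma winv_catl w : word_eq R (winv w ++ w) [::].
Proof.
elim: w => [|[i b] w IHw]; first exact: Weq_refl.
rewrite /winv /= rev_cons -cats1 -catA.
apply: Weq_trans IHw; apply: Weq_cat; first exact: Weq_refl.
apply: (@Weq_cat _ _ [:: (i, ~~ b); (i, b)] [::] w w); last exact: Weq_refl.
by have := Weq_cancel R i (~~ b); rewrite negbK.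
Qed.

Lemma presW (x : presented) : exists w, x = \pi_presented w.
Proof. by exists (repr x); rewrite reprK. Qed.

Lemma winvK : involutive winv.
Proof.
move=> w; rewrite /winv map_rev revK -map_comp -[RHS]map_id.
by apply: eq_map => -[i b]; rewrite /= negbK.
Qed.

Lemma pres_mulA : associative pres_mul.
Proof.
move=> x y z; have [[u ->] [v ->] [w ->]] := And3 (presW x) (presW y) (presW z).
by rewrite (pres_mulE v w) (pres_mulE u v) !pres_mulE catA.
Qed.

Lemma pres_mul1 : left_id pres_one pres_mul.
Proof. by move=> x; have [u ->] := presW x; rewrite /pres_one pres_mulE. Qed.

Lemma pres_mulr1 : right_id pres_one pres_mul.
Proof.
by move=> x; have [u ->] := presW x; rewrite /pres_one pres_mulE cats0.
Qed.

Lemma pres_mulV : left_inverse pres_one pres_inv pres_mul.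
Proof.
move=> x; rewrite -[in X in pres_mul _ X](reprK x) /pres_inv pres_mulE.
by apply/presentedP; apply: winv_catl.
Qed.

Lemma pres_mulrV : right_inverse pres_one pres_inv pres_mul.
Proof.
move=> x; rewrite -[in X in pres_mul X _](reprK x) /pres_inv pres_mulE.
by apply/presentedP; rewrite -{1}[repr x]winvK; apply: winv_catl.
Qed.

HB.instance Definition _ := isGroup.Build presented
  pres_mulA pres_mul1 pres_mulr1 pres_mulV pres_mulrV.

Definition pgen (i : I) : presented := \pi_presented (letter i).

Definition plift (G : groupType) (x : I -> G) (w : presented) : G :=
  eval_word x (repr w).

Section Lift.
Variables (G : groupType) (x : I -> G).
Hypothesis xR : forall r, R r -> eval_word x r = 1.

Lemma eval_cat u v : eval_word x (u ++ v) = eval_word x u * eval_word x v.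
Proof. by elim: u => [|a u IHu] /=; rewrite ?mul1g // IHu mulgA. Qed.

Lemma eval_word_eq u v : word_eq R u v -> eval_word x u = eval_word x v.
Proof.
elim=> {u v} //.
- by move=> u v w _ -> _ ->.
- by move=> u u' v v' _ uu' _ vv'; rewrite !eval_cat uu' vv'.
- by move=> i [] /=; rewrite /eval_letter mulg1 ?mulVg ?mulgV.
Qed.

Lemma pliftE w : plift x (\pi_presented w) = eval_word x w.
Proof. exact/eval_word_eq/repr_word_eq. Qed.

Lemma plift_gen i : plift x (pgen i) = x i.
Proof. by rewrite pliftE /= mulg1. Qed.

Lemma pliftM : {morph plift x : u v / u * v}.
Proof.
move=> x' y'; have [[u ->] [v ->]] := conj (presW x') (presW y').
have -> : \pi_presented u * \pi_presented v = \pi_presented (u ++ v) :> presented.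
  exact: pres_mulE.
by rewrite !pliftE eval_cat.
Qed.

Lemma plift1 : plift x 1 = 1.
Proof. exact: pliftE [::]. Qed.

End Lift.

Lemma eval_pgen (w : word I) : eval_word pgen w = \pi_presented w.
Proof.
have pM u v : \pi_presented u * \pi_presented v = \pi_presented (u ++ v)
  by exact: pres_mulE.
elim: w => [|[i b] w IHw] //=; rewrite IHw /eval_letter /=.
case: b; last by rewrite pM.
have -> : (pgen i)^-1 = \pi_presented [:: (i, true)].
  apply: (mulgI (pgen i)); rewrite mulgV pM /=.
  by apply/esym/presentedP; apply: (Weq_cancel _ i false).
by rewrite pM.
Qed.

Lemma eval_relator r : R r -> eval_word pgen r = 1.
Proof. by move=> Rr; rewrite eval_pgen; apply/presentedP/Weq_relator. Qed.

Lemma plift_pgen (u : presented) : plift pgen u = u.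
Proof. by rewrite /plift eval_pgen reprK. Qed.

End Presented.

(* G = < x_i (i : I) | r = 1 (r in R) >. *)
Definition has_presentation (I : choiceType) (G : groupType) (x : I -> G)
    (R : set (word I)) : Prop :=
  exists f : {multiplicative presented R -> G},
    bijective f /\ forall i, f (pgen R i) = x i.

Section Subgroups.
Variable G : groupType.

Definition subgroup_set (H : set G) : Prop :=
  [/\ H 1, forall x y, H x -> H y -> H (x * y) & forall x, H x -> H x^-1].

Definition generated (A : set G) : set G := smallest subgroup_set A.

Definition rcoset (A : set G) (g : G) : set G := [set x * g | x in A].

End Subgroups.

Definition parabolic (G : groupType) (n : nat) (t : 'I_n -> G) (J : {set 'I_n})
  : set G := generated [set t i | i in [set` J]].

Record C_group (G : groupType) (n : nat) (t : 'I_n -> G) : Prop := CGroup {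
  C_involution : forall i, t i <> 1 /\ t i ^+ 2 = 1;
  C_generate : parabolic t [set: 'I_n]%SET = setT;
  C_intersection : forall J K : {set 'I_n},
    parabolic t J `&` parabolic t K = parabolic t (J :&: K)%SET }.

Definition string_C_group (G : groupType) (n : nat) (t : 'I_n -> G) : Prop :=
  C_group t /\
  forall i j : 'I_n, (i.+2 <= j)%N || (j.+2 <= i)%N -> (t i * t j) ^+ 2 = 1.

(* The rank is n.+1: a regular polytope with vertices has rank at least 1. *)
Section Vertices.
Variables (n : nat) (G : groupType) (t : 'I_n.+1 -> G).

Definition vertex_stab : set G := parabolic t [set~ ord0]%SET.

Definition vertex := set_type (range (rcoset vertex_stab)).

Lemma vertex_act_subproof (F : vertex) (g : G) :
  rcoset (val F) g \in range (rcoset vertex_stab).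
Proof.
case: F => F /= /set_mem [h _ <-]; apply/mem_set; exists (h * g) => //.
rewrite eqEsubset; split=> x /=.
  by case=> y Hy <-; exists (y * h); [exists y | rewrite mulgA].
by case=> _ [y Hy <-] <-; exists y => //; rewrite mulgA.
Qed.

Definition vertex_act (F : vertex) (g : G) : vertex :=
  exist _ (rcoset (val F) g) (vertex_act_subproof F g).

Lemma base_vertex_subproof : vertex_stab \in range (rcoset vertex_stab).
Proof.
apply/mem_set; exists 1 => //; rewrite eqEsubset; split=> x /=.
  by case=> y Hy <-; rewrite mulg1.
by move=> Hx; exists x => //; rewrite mulg1.
Qed.

Definition base_vertex : vertex := exist _ vertex_stab base_vertex_subproof.

Lemma vertex_actM F g h : vertex_act F (g * h) = vertex_act (vertex_act F g) h.
Proof.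
apply: val_inj; rewrite /= eqEsubset; split=> x /=.
  by case=> y Fy <-; exists (y * g); [exists y | rewrite mulgA].
by case=> _ [y Fy <-] <-; exists y => //; rewrite mulgA.
Qed.

Lemma vertex_act1 F : vertex_act F 1 = F.
Proof.
apply: val_inj; rewrite /= eqEsubset; split=> x /=.
  by case=> y Fy <-; rewrite mulg1.
by move=> Fx; exists x => //; rewrite mulg1.
Qed.

End Vertices.

Record cs_polytope (n : nat) := CSPolytope {
  cs_group :> groupType;
  cs_gen : 'I_n.+1 -> cs_group;
  cs_string : string_C_group cs_gen;
  cs_alpha : cs_group;
  cs_alpha_involution : cs_alpha <> 1 /\ cs_alpha ^+ 2 = 1;
  cs_alpha_central : forall g, commute cs_alpha g;
  cs_alpha_proper : forall F : vertex cs_gen, vertex_act F cs_alpha <> F }.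

Section Twist.
Variables (n : nat) (P : cs_polytope n) (s : nat).
Local Notation V := (vertex (@cs_gen n P)).
Local Notation alpha := (@cs_alpha n P).

Inductive diagram_relator : set (word V) :=
| Diag_sq F : diagram_relator (wpow (letter F) 2)
| Diag_opp F :
    diagram_relator (wpow (letter F ++ letter (vertex_act F alpha)) s)
| Diag_comm F F' : F' <> F -> F' <> vertex_act F alpha ->
    diagram_relator (wpow (letter F ++ letter F') 2).

Definition diagram_group := presented diagram_relator.
HB.instance Definition _ := Group.on diagram_group.

Definition sigma (F : V) : diagram_group := pgen diagram_relator F.

Definition diagram_act (w : diagram_group) (g : P) : diagram_group :=
  plift (fun F => sigma (vertex_act F g)) w.

Lemma vertex_act_alpha (F : V) g :
  vertex_act (vertex_act F alpha) g = vertex_act (vertex_act F g) alpha.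
Proof. by rewrite -!vertex_actM cs_alpha_central. Qed.

Lemma vertex_act_inj g : injective (fun F : V => vertex_act F g).
Proof.
move=> F F' /(congr1 (fun E => vertex_act E g^-1)).
by rewrite -!vertex_actM mulgV !vertex_act1.
Qed.

Lemma eval_map g (w : word V) :
  eval_word (fun F => sigma (vertex_act F g)) w
  = eval_word sigma [seq (vertex_act a.1 g, a.2) | a <- w].
Proof. by elim: w => //= a w ->. Qed.

Lemma diagram_act_relator g r : diagram_relator r ->
  eval_word (fun F => sigma (vertex_act F g)) r = 1.
Proof.
move=> Rr; rewrite eval_map; apply: eval_relator.
case: Rr => {r} [F|F|F F' FF' FF'a].
- exact: Diag_sq.
- have := Diag_opp (vertex_act F g); rewrite -vertex_act_alpha.
  by rewrite /wpow map_flatten map_nseq.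
- have := @Diag_comm (vertex_act F g) (vertex_act F' g).
  rewrite -vertex_act_alpha; apply.
    by move/vertex_act_inj.
  by move/vertex_act_inj.
Qed.

Lemma diagram_act_sigma F g :
  diagram_act (sigma F) g = sigma (vertex_act F g).
Proof. exact/plift_gen/diagram_act_relator. Qed.

Lemma diagram_actM g :
  {morph (fun w => diagram_act w g) : v w / v * w >-> v * w}.
Proof. exact/pliftM/diagram_act_relator. Qed.

Lemma diagram_act1g g : diagram_act 1 g = 1.
Proof. exact/plift1/diagram_act_relator. Qed.

Lemma diagram_actV w g : diagram_act w^-1 g = (diagram_act w g)^-1.
Proof.
apply: (mulgI (diagram_act w g)).
by rewrite -diagram_actM !mulgV diagram_act1g.
Qed.

Lemma diagram_act_eval (x : V -> diagram_group) g (w : word V) :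
  diagram_act (eval_word x w) g
  = eval_word (fun F => diagram_act (x F) g) w.
Proof.
elim: w => [|[F b] w IHw] /=; first exact: diagram_act1g.
rewrite diagram_actM IHw /eval_letter /=.
by case: b => //; rewrite diagram_actV.
Qed.

Lemma diagram_act_comp w g h :
  diagram_act w (g * h) = diagram_act (diagram_act w g) h.
Proof.
rewrite [RHS](diagram_act_eval (fun F => sigma (vertex_act F g))).
congr (eval_word _ _); apply: funext => F.
by rewrite diagram_act_sigma vertex_actM.
Qed.

Lemma diagram_act_id w : diagram_act w 1 = w.
Proof.
rewrite -[RHS]plift_pgen /diagram_act; congr (plift _ _).
by apply: funext => F; rewrite vertex_act1.
Qed.

(* Twist w g stands for the product w g; thus
   (v, g) (w, h) = (v (g w g^-1), g h), where g w g^-1 is the image of w under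
   the right action of g^-1. *)
Record twist_group := Twist { twist_w : diagram_group; twist_g : P }.
HB.instance Definition _ := gen_eqMixin twist_group.
HB.instance Definition _ := gen_choiceMixin twist_group.

Definition twist_one : twist_group := Twist 1 1.
Definition twist_mul (x y : twist_group) : twist_group :=
  Twist (twist_w x * diagram_act (twist_w y) (twist_g x)^-1)
        (twist_g x * twist_g y).
Definition twist_inv (x : twist_group) : twist_group :=
  Twist (diagram_act (twist_w x)^-1 (twist_g x)) (twist_g x)^-1.

Lemma twist_mulA : associative twist_mul.
Proof.
move=> [u f] [v g] [w h]; rewrite /twist_mul /=.
by rewrite diagram_actM !mulgA invgM diagram_act_comp.
Qed.

Lemma twist_mul1 : left_id twist_one twist_mul.
Proof.
by move=> [w g]; rewrite /twist_mul /= !mul1g invg1 diagram_act_id.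
Qed.

Lemma twist_mulr1 : right_id twist_one twist_mul.
Proof. by move=> [w g]; rewrite /twist_mul /= diagram_act1g !mulg1. Qed.

Lemma twist_mulV : left_inverse twist_one twist_inv twist_mul.
Proof.
move=> [w g]; rewrite /twist_mul /= invgK -diagram_actM !mulVg.
by rewrite diagram_act1g.
Qed.

Lemma twist_mulrV : right_inverse twist_one twist_inv twist_mul.
Proof.
move=> [w g]; rewrite /twist_mul /= -diagram_act_comp mulgV diagram_act_id.
by rewrite !mulgV.
Qed.

HB.instance Definition _ := isGroup.Build twist_group
  twist_mulA twist_mul1 twist_mulr1 twist_mulV twist_mulrV.

Definition twist_gen (i : 'I_n.+2) : twist_group :=
  if unlift ord0 i is Some j then Twist 1 (cs_gen P j)
  else Twist (sigma (base_vertex (cs_gen P))) 1.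

Lemma twist_mulE (x y : twist_group) : x * y = twist_mul x y.
Proof. by []. Qed.

Lemma twist_conj (F : V) (g : P) :
  (Twist 1 g)^-1 * Twist (sigma F) 1 * Twist 1 g
  = Twist (sigma (vertex_act F g)) 1.
Proof.
have -> : (Twist 1 g)^-1 = Twist 1 g^-1.
  rewrite [LHS]/(twist_inv (Twist 1 g)) /twist_inv /=.
  by rewrite invg1 diagram_act1g.
rewrite !twist_mulE /twist_mul /= invgK diagram_act1g diagram_act_sigma.
by rewrite mul1g !mulg1 mulVg.
Qed.

End Twist.

(* G({2p}): the string C-group of rank 2 in which tau_0 tau_1 has order 2p,
   which is dihedral of order 4p. *)
Definition even_polygon (p : nat) (P : cs_polytope 1) : Prop :=
  let r : P := cs_gen P ord0 * cs_gen P ord_max in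
  (forall k : nat, r ^+ k = 1 <-> (2 * p %| k)%N) /\ cs_alpha P = r ^+ p.

(* The 2p-gon exists: the maps x |-> x + a and x |-> - x + a of Z/2p, acting on
   the right, with tau_0 : x |-> 1 - x and tau_1 : x |-> - x. *)
Section EvenPolygon.
Variable m : nat.
Local Notation Z := 'I_m.+1.

Record dih := Dih { dih_refl : bool; dih_shift : Z }.
HB.instance Definition _ := gen_eqMixin dih.
HB.instance Definition _ := gen_choiceMixin dih.

Definition dsign (b : bool) (x : Z) : Z := if b then (- x)%R else x.
Definition dih_one : dih := Dih false 0%R.
Definition dih_mul (f g : dih) : dih :=
  Dih (dih_refl f (+) dih_refl g)
      (dsign (dih_refl g) (dih_shift f) + dih_shift g)%R.
Definition dih_inv (f : dih) : dih :=
  Dih (dih_refl f) (dsign (~~ dih_refl f) (dih_shift f)).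

Lemma dih_mulA : associative dih_mul.
Proof.
move=> [a x] [b y] [c z]; rewrite /dih_mul /= addbA; congr Dih.
by case: b c => -[] /=; rewrite ?opprD ?opprK !addrA.
Qed.
Lemma dih_mul1 : left_id dih_one dih_mul.
Proof. by case=> [[] x]; rewrite /dih_mul /dih_one /= ?oppr0 add0r. Qed.
Lemma dih_mulr1 : right_id dih_one dih_mul.
Proof. by case=> [[] x]; rewrite /dih_mul /= addr0. Qed.
Lemma dih_mulV : left_inverse dih_one dih_inv dih_mul.
Proof.
by case=> [[] x]; rewrite /dih_mul /dih_inv /dih_one /= ?addrN ?addNr.
Qed.
Lemma dih_mulrV : right_inverse dih_one dih_inv dih_mul.
Proof.
by case=> [[] x]; rewrite /dih_mul /dih_inv /dih_one /= ?addrN ?addNr.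
Qed.

HB.instance Definition _ := isGroup.Build dih
  dih_mulA dih_mul1 dih_mulr1 dih_mulV dih_mulrV.

Definition dih_gen (i : 'I_2) : dih :=
  Dih true (if i == ord0 then inord 1 else 0%R).

Lemma dihM (f g : dih) : f * g = dih_mul f g.
Proof. by []. Qed.

Lemma dihV (f : dih) : f^-1 = dih_inv f.
Proof. by []. Qed.

Lemma dih_rot k : (dih_gen ord0 * dih_gen ord_max) ^+ k
  = Dih false (- (inord 1 *+ k))%R.
Proof.
have r : dih_gen ord0 * dih_gen ord_max = Dih false (- inord 1)%R.
  by rewrite dihM /dih_mul /= addr0.
rewrite r; elim: k => [|k IHk]; first by rewrite expg0 mulr0n oppr0.
by rewrite expgS IHk dihM /dih_mul /= mulrS opprD.
Qed.

Hypothesis m_gt0 : (0 < m)%N.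

Lemma inord1_mulrn k : (inord 1 *+ k)%R = inZp k :> Z.
Proof.
rewrite Zp_mulrn; apply: val_inj; rewrite /= inordK // mul1n.
by [].
Qed.

Lemma dih_gen_generate (H : set dih) : subgroup_set H ->
  (forall i, H (dih_gen i)) -> forall f, H f.
Proof.
move=> [H1 HM HV] Hg.
have HX g k : H g -> H (g ^+ k).
  by move=> Hgg; elim: k => [|k IHk]; rewrite ?expg0 // expgS; apply: HM.
have Hrot (x : Z) : H (Dih false x).
  have /HV := HX _ x (HM _ _ (Hg ord0) (Hg ord_max)); rewrite dih_rot.
  by rewrite dihV /dih_inv /= opprK inord1_mulrn valZpK.
case=> [[] x]; last exact: Hrot.
have := HM _ _ (Hrot (- x)%R) (Hg ord_max).
by rewrite dihM /dih_mul /= addr0 opprK.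
Qed.

Lemma parabolic_sub (G : groupType) n (t : 'I_n -> G) (J K : {set 'I_n}) :
  J \subset K -> parabolic t J `<=` parabolic t K.
Proof.
move=> /fintype.subsetP JK x + H [Hsub HK]; apply; split=> // _ [i Ji <-].
by apply: HK; exists i => //; apply: JK.
Qed.

Lemma dih_stab (J : {set 'I_2}) i x : J \subset [set i]%SET ->
  parabolic dih_gen J x -> x = 1 \/ x = dih_gen i.
Proof.
move=> /fintype.subsetP Ji.
apply: (@smallest_sub _ _ _ [set x | x = 1 \/ x = dih_gen i]); last first.
  by move=> _ [j /Ji + <-]; rewrite inE => /eqP ->; right.
have gg : dih_gen i * dih_gen i = 1 by rewrite dihM /dih_mul /= addNr.
split; first by left.
  by move=> u v [->|->] [->|->]; rewrite ?mul1g ?mulg1 ?gg; by [left | right].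
move=> u [->|->]; first by left; rewrite invg1.
by right; apply: (mulgI (dih_gen i)); rewrite [LHS]mulgV [RHS]gg.
Qed.

Lemma dih_C_group : C_group dih_gen.
Proof.
split.
- by move=> i; split=> //; rewrite expgS expg1 dihM /dih_mul /= addNr.
- apply/seteqP; split=> // f _ H [Hsub HJ].
  by apply: dih_gen_generate => // i; apply: HJ; exists i; rewrite //= inE.
move=> J K; apply/seteqP; split; last first.
  move=> f JKf; split; apply: parabolic_sub JKf.
    exact: finset.subsetIl.
  exact: finset.subsetIr.
have [JK|/fintype.subsetPn[i Ji Ki]] := boolP (J \subset K).
  by move=> f [Jf _]; rewrite (finset.setIidPl JK).
have [KJ|/fintype.subsetPn[j Kj Jj]] := boolP (K \subset J).
  by move=> f [_ Kf]; rewrite (finset.setIidPr KJ).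
have ij : i != j by apply: contraNneq Jj => <-.
have I2 (k : 'I_2) : k = i \/ k = j.
  move: ij; case: i j k {Ji Ki Kj Jj} => [[|[|//]] ?] [[|[|//]] ?] [[|[|//]] ?];
  by rewrite -val_eqE => //= _; (try by left; apply: val_inj);
     right; apply: val_inj.
have sJ : J \subset [set i]%SET.
  apply/fintype.subsetP => k; rewrite inE; case: (I2 k) => -> // Jj'.
  by rewrite Jj' in Jj.
have sK : K \subset [set j]%SET.
  apply/fintype.subsetP => k; rewrite inE; case: (I2 k) => -> // Ki'.
  by rewrite Ki' in Ki.
move=> f [/(dih_stab sJ) Hf /(dih_stab sK) Hf'].
have -> : f = 1.
  case: Hf Hf' => -> // [] // /(congr1 dih_shift) /=.
  move: ij; case: (I2 ord0) => <-; rewrite ?eqxx ?[_ == ord0]eq_sym => /negPf ->.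
    by move=> /(congr1 val); rewrite /= inordK.
  by move=> /(congr1 val); rewrite /= inordK.
by move=> H [[]].
Qed.

End EvenPolygon.

Lemma even_polygon_exists p : (0 < p)%N ->
  exists P : cs_polytope 1, even_polygon p P.
Proof.
case: p => // p _; pose m := (p.*2.+1)%N.
have mE : m.+1 = (2 * p.+1)%N by rewrite mul2n.
have m0 : (0 < m)%N by [].
pose t := @dih_gen m; pose a : dih m := (t ord0 * t ord_max) ^+ p.+1.
have aE : a = Dih false (inZp p.+1).
  rewrite /a dih_rot inord1_mulrn //; congr Dih.
  apply/esym/eqP; rewrite -addr_eq0; apply/eqP/val_inj => /=.
  by rewrite modnDm addnn -mul2n -mE modnn.
have a1 : a <> 1.
  rewrite aE => /(congr1 (@dih_shift _)) /(congr1 val) /=; rewrite modn_small // mE.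
  by rewrite mul2n -addnn -addSnnS leq_addr.
have aa : a ^+ 2 = 1.
  by rewrite /a -expgnA mulnC -mE dih_rot inord1_mulrn //; congr Dih;
    apply: val_inj; rewrite /= modnn subn0 modnn.
have aN : (- inZp p.+1)%R = inZp p.+1 :> 'I_m.+1.
  move: aa; rewrite expgS expg1 aE dihM /dih_mul /= => /(congr1 (@dih_shift _)) /= /eqP.
  by rewrite addr_eq0 => /eqP <-.
have aC g : commute a g.
  rewrite /commute aE !dihM /dih_mul /= addbF; case: g => [[] x] /=; rewrite ?aN addrC //.
have anf (F : vertex t) : vertex_act F a <> F.
  case: F => F FP /(congr1 val) /=.
  case/set_mem: (FP) => g _ <- E.
  have : rcoset (rcoset (vertex_stab t) g) a (g * a).
    exists g => //; exists 1; last by rewrite mul1g.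
    by move=> H [[]].
  rewrite E -aC => -[h Hh /mulIg ha]; rewrite ha in Hh.
  have [//|/(congr1 (@dih_refl _))] : a = 1 \/ a = t ord_max.
    apply: dih_stab Hh; apply/fintype.subsetP => k; rewrite !inE.
    by case: k => [[|[|//]] ?].
  by rewrite aE.
have st : string_C_group t.
  split; first exact: dih_C_group.
  by move=> [[|[|//]] ?] [[|[|//]] ?].
exists (CSPolytope st (conj a1 aa) aC anf); split=> // k.
rewrite /= -/t dih_rot inord1_mulrn // -mE; split.
  by move=> /(congr1 (@dih_shift _)) /= /eqP; rewrite oppr_eq0 => /eqP /(congr1 val) /= /eqP.
move=> mk; congr Dih; apply/eqP; rewrite oppr_eq0; apply/eqP/val_inj.
by apply/eqP.
Qed.

Definition x0 : word 'I_3 := letter (@Ordinal 3 0 isT).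
Definition x1 : word 'I_3 := letter (@Ordinal 3 1 isT).
Definition x2 : word 'I_3 := letter (@Ordinal 3 2 isT).

(* [p, q | h_2, ..., h_k] with k = q./2 and h = [:: h_2; ...; h_k]. *)
Inductive bracket_relator (p q : nat) (h : seq nat) : set (word 'I_3) :=
| Br_sq0 : bracket_relator p q h (wpow x0 2)
| Br_sq1 : bracket_relator p q h (wpow x1 2)
| Br_sq2 : bracket_relator p q h (wpow x2 2)
| Br_01 : bracket_relator p q h (wpow (x0 ++ x1) p)
| Br_12 : bracket_relator p q h (wpow (x1 ++ x2) q)
| Br_02 : bracket_relator p q h (wpow (x0 ++ x2) 2)
| Br_hole j : (2 <= j <= q./2)%N ->
    bracket_relator p q h
      (wpow (x0 ++ x1 ++ wpow (x2 ++ x1) (j - 1)) (nth 0%N h (j - 2))).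

(* Main.v *)
Require Import Defs.
From mathcomp Require Import all_boot.
From mathcomp Require Import boolp classical_sets.
From HB Require Import structures.

(** Write a, b, c for three generators of a group and r = b c.  If a, b, c are
involutions and a commutes with c, then b (c b)^(j-1) = c r^(-j) is a
reflection of the dihedral group <b, c>, and since c commutes with a,
[(a b (c b)^(j-1))^2 = a * a^(r^(-j))] (lemma [hole_sqr]).
So the relators of [4, 2p | 4^(p-2), 2s] say exactly this
([bracket_relatorsP]): a, b, c are involutions, r^(2p) = 1, a commutes with c
and with its conjugates by r^(-j) for 0 < j < p, and the product of a with its
conjugate by r^(-p) has order dividing s.  The relator (a b)^4 is the case
j = 1 of the same pattern.

In the polygon, c = tau_1 fixes the base vertex F_0, every vertex is of the
form F_0 r^(-k) with 0 <= k < 2p, and alpha = r^p; the conjugates of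
a = sigma_(F_0) by the powers of r are therefore the generators sigma_F of W.
The relations above are then the Coxeter relations of W between sigma_(F_0) and
the other generators, together with the presentation of the dihedral group and
its compatibility with the action on vertices.  They hold in the semidirect
product ([twist_bracket_relators]).

Conversely, let a, b, c satisfy them in a group G.  The polygon group, being
dihedral of order 4p, maps to G by tau_0 -> b, tau_1 -> c ([dihedral_lift]); as
c commutes with a, sending F_0 g to the conjugate of a by the image of g is well
defined ([orbit_conj]) and equivariant.  By equivariance the Coxeter relations
need only be verified at F_0, where conjugation by c turns F_0 r^(-k) into
F_0 r^k and so reduces the range p < k < 2p to 0 < k < p.  Hence the semidirect
product maps to G ([twist_lift_bracket]).  Applied to the presented group this
inverts the map induced by the relators ([has_presentation_lift]). *)

Set Implicit Arguments.
Unset Strict Implicit.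
Unset Printing Implicit Defensive.
Local Open Scope classical_set_scope.
Local Open Scope group_scope.

(** * Homomorphisms and generation *)

Notation "{ 'hom' G -> K }" := (UMagmaMorphism.type G%type K%type)
  (at level 0, G at level 98, K at level 99) : type_scope.

Lemma morph_hom (G K : groupType) (f : G -> K) :
  {morph f : x y / x * y} -> exists F : {hom G -> K}, F = f :> (G -> K).
Proof.
move=> fM; have f1 : f 1 = 1 by apply: (mulgI (f 1)); rewrite -fM !mulg1.
pose fm := isUMagmaMorphism.Build G K f (f1, fM).
by pose F : {hom G -> K} := HB.pack f fm; exists F.
Qed.

Section Generation.
Variable G : groupType.
Implicit Types (A H : set G).

Lemma generated_subgroup A : subgroup_set (generated A).
Proof.
split=> [H [[]]//|x y Ax Ay H HA|x Ax H HA]; have [[_ HM HV] _] := HA.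
  by apply: HM; [apply: Ax | apply: Ay].
by apply: HV; apply: Ax.
Qed.

Lemma sub_generated A : A `<=` generated A.
Proof. by move=> x Ax H [_]; apply. Qed.

Lemma generated_min A H : subgroup_set H -> A `<=` H -> generated A `<=` H.
Proof. by move=> sH AH x; apply. Qed.

End Generation.

Section Morphisms.
Variables G K : groupType.
Implicit Types f g : {hom G -> K}.

Lemma equalizer_subgroup f g : subgroup_set [set x | f x = g x].
Proof.
split=> [|x y /= fx fy|x /= fx]; first by rewrite /= !gmulf1.
  by rewrite !gmulfM fx fy.
by rewrite !gmulfV fx.
Qed.

Lemma preimage_subgroup f (H : set K) :
  subgroup_set H -> subgroup_set (f @^-1` H).
Proof.
move=> [H1 HM HV]; split=> [|x y Hx Hy|x Hx]; rewrite /preimage /=.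
- by rewrite gmulf1.
- by rewrite gmulfM; apply: HM.
- by rewrite gmulfV; apply: HV.
Qed.

Lemma centralizer_subgroup (a : G) : subgroup_set [set x | commute a x].
Proof.
split=> [|x y|x]; rewrite /=; [exact: commute1|exact: commuteM|exact: commuteV].
Qed.

Lemma gmulf_eval (I : Type) f (x : I -> G) w :
  f (eval_word x w) = eval_word (f \o x) w.
Proof.
elim: w => [|[i b] w IHw] /=; first exact: gmulf1.
by rewrite gmulfM IHw /eval_letter; case: b; rewrite //= gmulfV.
Qed.

(** Goursat: a subgroup of a product that projects bijectively onto the first
factor is the graph of a homomorphism.  Single-valuedness has to be checked in
the fibre over 1 only. *)
Lemma graph_morphism (S : set (G * K)) : subgroup_set S ->
    (forall x, exists y, S (x, y)) -> (forall y, S (1, y) -> y = 1) ->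
  exists f : {hom G -> K}, forall x y, S (x, y) -> f x = y.
Proof.
move=> [_ SM SV] Stot S1.
have Sfun x y z : S (x, y) -> S (x, z) -> y = z.
  move=> /SM Sy /SV /Sy; rewrite [X in S X](_ : _ = (1, y * z^-1)).
    by move=> /S1 /divg1_eq.
  by congr pair; apply: mulgV.
have [f Sf] := choice Stot.
have fM : {morph f : x y / x * y}.
  by move=> x y; apply: Sfun (Sf _) _; apply: SM (Sf x) (Sf y).
have [F FE] := morph_hom fM.
by exists F => x y; rewrite FE; apply: Sfun; apply: Sf.
Qed.

End Morphisms.

(** * Presentations *)

Section Words.
Variables (I : choiceType) (G : groupType) (x : I -> G).

Lemma eval_wpow w n : eval_word x (wpow w n) = eval_word x w ^+ n.
Proof.
elim: n => [|n IHn]; first by rewrite expg0.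
by rewrite expgS -IHn; apply: eval_cat.
Qed.

Lemma eval_wletter i : eval_word x (letter i) = x i.
Proof. exact: mulg1. Qed.

Lemma eval_conj w z : eval_word x w ^ z = eval_word (fun i => x i ^ z) w.
Proof.
elim: w => [|[i b] w IHw] /=; first exact: conj1g.
by rewrite conjMg IHw /eval_letter; case: b; rewrite //= conjVg.
Qed.

End Words.

Section Presentations.
Variables (I : choiceType) (R : set (word I)).

Lemma presented_generated (H : set (presented R)) : subgroup_set H ->
  (forall i, H (pgen R i)) -> forall u, H u.
Proof.
move=> [H1 HM HV] Hg u; have [w ->] := presW u; rewrite -eval_pgen.
elim: w => [|[i b] w IHw] //=; apply: HM => //.
by rewrite /eval_letter; case: b => //=; apply: HV.
Qed.

Lemma presented_lift (G : groupType) (x : I -> G) :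
    (forall r, R r -> eval_word x r = 1) ->
  exists f : {hom presented R -> G},
    forall w, f (\pi_(presented R)%qT w) = eval_word x w.
Proof.
move=> xR.
have [f fE] := morph_hom (pliftM xR).
by exists f => w; rewrite fE; apply: pliftE.
Qed.

(** The two homomorphisms are mutually inverse because each composite agrees
with the identity on generators. *)
Lemma has_presentation_lift (G : groupType) (x : I -> G) :
    (forall r, R r -> eval_word x r = 1) ->
    (forall H : set G, subgroup_set H -> (forall i, H (x i)) -> H = setT) ->
    (exists g : {hom G -> presented R},
       forall i, g (x i) = pgen R i) ->
  has_presentation x R.
Proof.
move=> /presented_lift[f fE] genx [g gx].
have fx i : f (pgen R i) = x i by rewrite /pgen fE eval_wletter.
exists f; split=> //; exists g => [u|t].
  apply: (presented_generated (equalizer_subgroup (g \o f) idfun)) => i /=.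
  by rewrite fx gx.
have := genx _ (equalizer_subgroup (f \o g) idfun).
suff fgx i : [set t | (f \o g) t = idfun t] (x i).
  by move=> /(_ fgx)/seteqP[_ /(_ t)]; apply.
by rewrite /= gx fx.
Qed.

End Presentations.

(** * Dihedral groups *)

Lemma involution_inv (G : groupType) (x : G) : x ^+ 2 = 1 -> x^-1 = x.
Proof. exact: mulg1_eq. Qed.

Lemma involutions_commuteP (G : groupType) (x y : G) :
  x ^+ 2 = 1 -> y ^+ 2 = 1 -> (x * y) ^+ 2 = 1 <-> commute x y.
Proof.
move=> x2 y2; split=> [xy2|xy]; last by rewrite expgMn // x2 y2 mul1g.
by rewrite /commute -(involution_inv xy2) invgM !involution_inv.
Qed.

Section Dihedral.
Variables (G : groupType) (x y : G).
Hypotheses (x2 : x ^+ 2 = 1) (y2 : y ^+ 2 = 1).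

Lemma rotation_conj k : ((x * y) ^+ k) ^ y = (x * y) ^- k.
Proof.
rewrite conjXg conjgE -[_ * y * y]mulgA -expg2 y2 mulg1.
by rewrite -expVgn invgM (involution_inv x2).
Qed.

(** The normal forms are closed under multiplication because y inverts the
rotation; finiteness of the order of x y makes non-negative exponents
suffice. *)
Lemma dihedral_normal_form n g : (0 < n)%N -> (x * y) ^+ n = 1 ->
    generated [set x; y] g ->
  exists k (b : bool), (k < n)%N /\ g = (x * y) ^+ k * y ^+ b.
Proof.
move=> n_gt0 rn Hg.
suff [k [b ->]] : exists k (b : bool), g = (x * y) ^+ k * y ^+ b.
  exists (k %% n)%N, b; split; first exact: ltn_pmod.
  by rewrite [in LHS](divn_eq k n) expgnDr mulnC expgnA rn expg1n mul1g.
have rV k : exists l, (x * y) ^- k = (x * y) ^+ l.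
  exists (k * n.-1)%N; apply: mulg1_eq.
  by rewrite -expgnDr -mulnS prednK // mulnC expgnA rn expg1n.
have yV := involution_inv y2.
have yr k : y * (x * y) ^+ k = (x * y) ^- k * y.
  by rewrite -rotation_conj conjgE -!mulgA -expg2 y2 mulg1 yV.
have rot b : y ^+ (~~ b) = y * y ^+ b.
  by case: b; rewrite /= ?mulg1 // -expg2 y2.
move: g Hg; apply: generated_min; last first.
  move=> _ [->|->] /=; last by exists 0%N, true; rewrite mul1g.
  by exists 1%N, true; rewrite -mulgA -expg2 y2 mulg1.
split; first by exists 0%N, false; rewrite mul1g.
- move=> _ _ [k [[] ->]] [l [b ->]]; last first.
    by exists (k + l)%N, b; rewrite expg0 mulg1 expgnDr mulgA.
  have [m lm] := rV l; exists (k + m)%N, (~~ b).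
  by rewrite expg1 expgnDr -lm rot -!mulgA (mulgA y) yr !mulgA.
move=> _ [k [[] ->]].
  exists k, true; rewrite expg1; apply: mulg1_eq.
  by rewrite -mulgA (mulgA y) yr -mulgA -expg2 y2 mulg1 mulgV.
by have [l kl] := rV k; exists l, false; rewrite expg0 !mulg1.
Qed.

(** Were y a power of x y, it would commute with x y, which it also inverts, so
x y would have order at most 2. *)
Lemma reflection_neq_rotation n k : (2 < n)%N ->
  (forall l, (x * y) ^+ l = 1 <-> (n %| l)%N) -> y <> (x * y) ^+ k.
Proof.
move=> n_gt2 ordn yE; have := rotation_conj 1.
rewrite expg1 {2}yE conjgE -expgS expgSr mulKg => rV.
have /ordn : (x * y) ^+ 2 = 1 by rewrite expg2 {1}rV mulVg.
by move=> /(dvdn_leq (isT : (0 < 2)%N)); rewrite leqNgt n_gt2.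
Qed.

End Dihedral.

(** The universal property of a dihedral group known only through the order of
its rotation.  The subgroup of D * G generated by (x, u) and (y, v) is the graph
of the required map: by the normal form, an element of it over 1 is
((x y)^k, (u v)^k) with n dividing k. *)
Lemma dihedral_lift (D G : groupType) (x y : D) (u v : G) n :
    x ^+ 2 = 1 -> y ^+ 2 = 1 -> generated [set x; y] = setT ->
    (2 < n)%N -> (forall k, (x * y) ^+ k = 1 <-> (n %| k)%N) ->
    u ^+ 2 = 1 -> v ^+ 2 = 1 -> (u * v) ^+ n = 1 ->
  exists f : {hom D -> G}, f x = u /\ f y = v.
Proof.
move=> x2 y2 genxy n_gt2 ordn u2 v2 uvn.
pose X : D * G := (x, u); pose Y : D * G := (y, v).
have XYX k : (X * Y) ^+ k = ((x * y) ^+ k, (u * v) ^+ k).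
  elim: k => // k IHk; rewrite !expgS IHk //.
have X2 : X ^+ 2 = 1 by congr pair.
have Y2 : Y ^+ 2 = 1 by congr pair.
have yr := reflection_neq_rotation x2 y2 n_gt2 ordn.
have [f fE] : exists f : {hom D -> G},
    forall d g, generated [set X; Y] (d, g) -> f d = g.
  apply: graph_morphism; first exact: generated_subgroup.
    move=> d; have : generated [set x; y] d by rewrite genxy.
    move: d; apply: generated_min; last first.
      move=> _ [->|->]; [exists u|exists v]; apply: sub_generated.
        by left.
      by right.
    have [S1 SM SV] := generated_subgroup [set X; Y].
    split=> [|d e [g Sg] [h Sh]|d [g Sg]]; first by exists 1.
      by exists (g * h); apply: SM Sg Sh.
    by exists g^-1; apply: SV Sg.
  have n_gt0 : (0 < n)%N by apply: leq_trans n_gt2.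
  have XYn : (X * Y) ^+ n = 1.
    by rewrite XYX uvn; congr pair; apply/ordn.
  move=> g /(dihedral_normal_form X2 Y2 n_gt0 XYn)[k [[] [kn]]].
    rewrite XYX expg1 => -[/esym/eqP + _]; rewrite mulg_eq1 (involution_inv y2).
    by move=> /eqP/esym/yr.
  rewrite XYX mulg1 => -[/esym/ordn + ->].
  by case: k kn => // k kn /(dvdn_leq (ltn0Sn k)); rewrite leqNgt kn.
by exists f; split; apply: fE; apply: sub_generated; [left|right].
Qed.

(** * The hole relators *)

Section Hole.
Variables (G : groupType) (a b c : G).
Hypotheses (a2 : a ^+ 2 = 1) (b2 : b ^+ 2 = 1) (c2 : c ^+ 2 = 1).
Hypothesis ac : commute a c.

(** The factor b (c b)^(j-1) equals c r^(-j), where r = b c, and this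
reflection is its own inverse r^j c; in the square, c cancels against c
across a. *)
Lemma hole_sqr j : (0 < j)%N ->
  (a * (b * (c * b) ^+ (j - 1))) ^+ 2 = a * a ^ (b * c) ^- j.
Proof.
move=> j_gt0; have cV := involution_inv c2.
have cb : c * b = (b * c)^-1 by rewrite invgM !involution_inv.
have -> : b * (c * b) ^+ (j - 1) = c * (b * c) ^- j.
  apply: (mulgI c); rewrite !mulgA -expg2 c2 mul1g cb -expVgn -expgS.
  by rewrite subn1 prednK.
have flip : c * (b * c) ^- j = (b * c) ^+ j * c.
  by rewrite -(rotation_conj b2 c2) conjgE cV !mulgA -expg2 c2 mul1g.
rewrite expg2 -[LHS]mulgA; congr (a * _).
rewrite {1}flip /conjg invgK -mulgA; congr (_ * _).
by rewrite !mulgA -ac -(mulgA a) -expg2 c2 mulg1.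
Qed.

(** Conjugation by c fixes a and inverts b c. *)
Lemma conj_rotation_commute j :
  commute a (a ^ (b * c) ^- j) -> commute a (a ^ (b * c) ^+ j).
Proof.
move=> /(congr1 (conjg^~ c)); rewrite conjMg [RHS]conjMg -!conjgM.
have -> : a ^ c = a by rewrite /conjg ac mulKg.
suff -> : a ^ ((b * c) ^- j * c) = a ^ (b * c) ^+ j by [].
rewrite (conjgC ((b * c) ^- j)) conjgM [a ^ c]/conjg ac mulKg conjVg.
by rewrite rotation_conj ?invgK.
Qed.

End Hole.

(** * Vertices and the semidirect product *)

Section Orbit.
Variables (n : nat) (G : groupType) (t : 'I_n.+1 -> G).
Local Notation F0 := (base_vertex t).

Lemma vertexP (F : vertex t) : exists g, F = vertex_act F0 g.
Proof.
by case: F => F FP; have [g _ gF] := set_mem FP; exists g; apply: val_inj.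
Qed.

Lemma base_vertex_stab g h :
  vertex_act F0 g = vertex_act F0 h -> vertex_stab t (g * h^-1).
Proof.
have [S1 SM _] := generated_subgroup [set t i | i in [set` [set~ ord0]%SET]].
move=> /(congr1 val)/= E; have : rcoset (vertex_stab t) g g.
  by exists 1; rewrite ?mul1g.
by rewrite E => -[k Sk <-]; rewrite mulgK.
Qed.

(** Well defined because the stabilizer of the base vertex, generated by the
t i with i <> 0, acts on a trivially through f. *)
Lemma orbit_conj (K : groupType) (f : {hom G -> K}) (a : K) :
    (forall i, i != ord0 -> commute a (f (t i))) ->
  exists x : vertex t -> K, forall g, x (vertex_act F0 g) = a ^ f g.
Proof.
move=> at_; have [rep repE] := choice vertexP.
exists (fun F => a ^ f (rep F)) => g; set h := rep _.
have : vertex_stab t (h * g^-1) by apply: base_vertex_stab; rewrite -repE.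
have sH := preimage_subgroup f (centralizer_subgroup a).
move=> /(generated_min sH); rewrite /preimage /= => ahg.
rewrite -[h](mulgVK g) [f (h * _ * g)]gmulfM conjgM; congr (_ ^ _).
rewrite /conjg ahg ?mulKg // => _ [i i0 <-].
by apply: at_; move: i0; rewrite /= finset.in_setC finset.in_set1.
Qed.

End Orbit.

Section Twist.
Variables (n : nat) (P : cs_polytope n) (s : nat).
Local Notation V := (vertex (@cs_gen n P)).
Local Notation T := (twist_group P s).

Definition twist_diagram (w : diagram_group P s) : T := Twist w 1.
Definition twist_polytope (g : P) : T := Twist 1 g.

Fact twist_diagramM : {morph twist_diagram : v w / v * w}.
Proof.
move=> v w; rewrite twist_mulE /twist_mul /= invg1 diagram_act_id mulg1.
by [].
Qed.

Fact twist_polytopeM : {morph twist_polytope : g h / g * h}.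
Proof. by move=> g h; rewrite twist_mulE /twist_mul /= diagram_act1g mulg1. Qed.

HB.instance Definition _ := isUMagmaMorphism.Build (diagram_group P s) T
  twist_diagram (erefl, twist_diagramM).
HB.instance Definition _ := isUMagmaMorphism.Build P T
  twist_polytope (erefl, twist_polytopeM).

Lemma twist_split w g : Twist w g = twist_diagram w * twist_polytope g.
Proof. by rewrite twist_mulE /twist_mul /= diagram_act1g mulg1 mul1g. Qed.

Lemma twist_sigma_conj (F : V) g :
  twist_diagram (sigma s F) ^ twist_polytope g
  = twist_diagram (sigma s (vertex_act F g)).
Proof. by rewrite -[RHS]twist_conj -mulgA. Qed.

Lemma twist_gen0 : twist_gen P s ord0 = twist_diagram (sigma s (base_vertex _)).
Proof. by rewrite /twist_gen unlift_none. Qed.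

Lemma twist_genS i :
  twist_gen P s (lift ord0 i) = twist_polytope (cs_gen P i).
Proof. by rewrite /twist_gen liftK. Qed.

(** The generators after the first generate the polytope group, whose action
carries the first one to all sigma_F, since the action on vertices is
transitive. *)
Lemma twist_generated (H : set T) :
  subgroup_set H -> (forall i, H (twist_gen P s i)) -> H = setT.
Proof.
move=> sH Hgen; have [H1 HM HV] := sH.
have Hg g : H (twist_polytope g).
  have sK := preimage_subgroup twist_polytope sH.
  have [_ genP _] := (cs_string P).1.
  have : parabolic (cs_gen P) [set: _]%SET g by rewrite genP.
  apply: (generated_min sK) => _ [i _ <-].
  by rewrite /preimage /= -twist_genS.
have Hs (F : V) : H (twist_diagram (sigma s F)).
  have [g ->] := vertexP F; rewrite -twist_sigma_conj /conjg -twist_gen0.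
  by apply: (HM); [apply: HV | apply: HM].
apply/seteqP; split=> // -[w g] _; rewrite twist_split; apply: HM => //.
exact: presented_generated (preimage_subgroup twist_diagram sH) Hs w.
Qed.

(** The universal property of the semidirect product: equivariance says that
the image of the action on the diagram group is conjugation by f g. *)
Lemma twist_lift (G : groupType) (f : {hom P -> G}) (x : V -> G) :
    (forall r, diagram_relator s r -> eval_word x r = 1) ->
    (forall F g, x (vertex_act F g) = x F ^ f g) ->
  exists h : {hom T -> G}, (forall F, h (twist_diagram (sigma s F)) = x F) /\
    forall g, h (twist_polytope g) = f g.
Proof.
move=> /presented_lift[phi phiE] xf.
have phi_sigma F : phi (sigma s F) = x F by rewrite phiE eval_wletter.
have phi_act w g : phi (diagram_act w g) = phi w ^ f g.
  rewrite gmulf_eval -[in RHS](plift_pgen w) gmulf_eval eval_conj.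
  by congr eval_word; apply: funext => F /=; rewrite !phi_sigma.
pose h (t : T) := phi (twist_w t) * f (twist_g t).
have hM : {morph h : t u / t * u}.
  move=> [v g] [w k]; rewrite /h /= !gmulfM phi_act gmulfV.
  by rewrite /conjg invgK -!mulgA mulKg.
have [H HE] := morph_hom hM; exists H; rewrite HE.
by split=> [F|g]; rewrite /h /= gmulf1 ?mulg1 ?mul1g.
Qed.

End Twist.

(** Commutation with the conjugates by (b c)^(-j) for 0 < j < p absorbs all
relators of exponent 4, including (a b)^4, which is the case j = 1. *)
Definition bracket_triple (G : groupType) p s (a b c : G) : Prop :=
  [/\ [/\ a ^+ 2 = 1, b ^+ 2 = 1 & c ^+ 2 = 1],
      commute a c, (b * c) ^+ (2 * p) = 1,
      forall j, (0 < j < p)%N -> commute a (a ^ (b * c) ^- j)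
    & (a * a ^ (b * c) ^- p) ^+ s = 1].

(** Each hole relator has even exponent, so it is a power of the square computed
in [hole_sqr]; for a product of two involutions, exponent 2 means
commutation. *)
Lemma bracket_relatorsP (G : groupType) (x : 'I_3 -> G) p s : (2 <= p)%N ->
  (forall r,
     bracket_relator 4 (2 * p)%N (rcons (nseq (p - 2)%N 4) (2 * s)%N) r ->
     eval_word x r = 1) <->
  bracket_triple p s (x (@Ordinal 3 0 isT)) (x (@Ordinal 3 1 isT))
    (x (@Ordinal 3 2 isT)).
Proof.
move=> p_ge2; set a := x _; set b := x _; set c := x _.
have p_half : ((2 * p)./2 = p)%N by rewrite mul2n doubleK.
have hole_expn j m : a ^+ 2 = 1 -> b ^+ 2 = 1 -> c ^+ 2 = 1 -> commute a c ->
    (0 < j)%N ->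
  (a * (b * (c * b) ^+ (j - 1)%N)) ^+ (2 * m) = (a * a ^ (b * c) ^- j) ^+ m.
  by move=> a2 b2 c2 ac j_gt0; rewrite expgnA hole_sqr.
have conj_sqr g : a ^+ 2 = 1 -> (a ^ g) ^+ 2 = 1.
  by move=> a2; rewrite -conjXg a2 conj1g.
have nth_lt j : (2 <= j < p)%N ->
    nth 0%N (rcons (nseq (p - 2)%N 4) (2 * s)%N) (j - 2)%N = 4.
  move=> /andP[j2 jp]; rewrite nth_rcons size_nseq nth_nseq.
  by rewrite ltn_sub2r // (leq_ltn_trans j2).
have nth_p : nth 0%N (rcons (nseq (p - 2)%N 4) (2 * s)%N) (p - 2)%N = (2 * s)%N.
  by rewrite nth_rcons size_nseq ltnn eqxx.
have evalE := (eval_wpow, eval_cat, eval_wletter).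
split=> [rel|[[a2 b2 c2] ac rp near opp] _ [||||||j]].
- have a2 : a ^+ 2 = 1 by have := rel _ (Br_sq0 _ _ _); rewrite !evalE.
  have b2 : b ^+ 2 = 1 by have := rel _ (Br_sq1 _ _ _); rewrite !evalE.
  have c2 : c ^+ 2 = 1 by have := rel _ (Br_sq2 _ _ _); rewrite !evalE.
  have ac : commute a c.
    apply/involutions_commuteP => //.
    by have := rel _ (Br_02 _ _ _); rewrite !evalE.
  have hole j : (2 <= j <= p)%N ->
    (a * (b * (c * b) ^+ (j - 1)%N)) ^+
      nth 0%N (rcons (nseq (p - 2)%N 4) (2 * s)%N) (j - 2)%N = 1.
    rewrite -{1}p_half => jp.
    by have := rel _ (Br_hole _ _ jp); rewrite !evalE.
  split=> //.
  + by have := rel _ (Br_12 _ _ _); rewrite !evalE.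
  + move=> j /andP[j_gt0 jp]; apply/involutions_commuteP => //.
      exact: conj_sqr.
    rewrite -hole_expn //; case: j j_gt0 jp => [|[|j]] // _ jp.
      by have := rel _ (Br_01 _ _ _); rewrite subnn expg0 mulg1 !evalE.
    by have := hole j.+2; rewrite nth_lt //; apply; rewrite /= ltnW.
  + rewrite -hole_expn // ?(ltnW p_ge2) // -nth_p.
    by apply: hole; rewrite p_ge2 /=.
- by rewrite !evalE.
- by rewrite !evalE.
- by rewrite !evalE.
(* (a b)^4 is the hole relator with j = 1, whose factor (c b)^0 is trivial. *)
- rewrite !evalE -/a -/b -[b]mulg1 -(expg0 (c * b)) -(subnn 1%N).
  rewrite (hole_expn 1%N 2) //.
  by apply/involutions_commuteP/near; rewrite ?conj_sqr //= p_ge2.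
- by rewrite !evalE.
- by rewrite !evalE; apply/involutions_commuteP.
rewrite p_half => /andP[j2]; rewrite leq_eqVlt !evalE => /predU1P[->|jp].
  by rewrite nth_p hole_expn // ltnW.
rewrite nth_lt ?j2 // (hole_expn j 2) // ?(ltnW j2) //.
by apply/involutions_commuteP/near; rewrite ?conj_sqr //= jp (ltnW j2).
Qed.

Section DiagramGenerators.
Variables (n : nat) (P : cs_polytope n) (s : nat).
Local Notation V := (vertex (@cs_gen n P)).

Lemma sigma_sqr (F : V) : sigma s F ^+ 2 = 1.
Proof.
by have := eval_relator (Diag_sq s F); rewrite eval_wpow eval_wletter.
Qed.

Lemma sigma_opp (F : V) :
  (sigma s F * sigma s (vertex_act F (cs_alpha P))) ^+ s = 1.
Proof.
have := eval_relator (Diag_opp s F).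
by rewrite eval_wpow eval_cat !eval_wletter.
Qed.

Lemma sigma_commute (F F' : V) : F' <> F -> F' <> vertex_act F (cs_alpha P) ->
  commute (sigma s F) (sigma s F').
Proof.
move=> FF' FF'a; apply/involutions_commuteP; try exact: sigma_sqr.
have := eval_relator (Diag_comm s FF' FF'a).
by rewrite eval_wpow eval_cat !eval_wletter.
Qed.

End DiagramGenerators.

(** * The even polygon *)

Section Polygon.
Variables (p : nat) (P : cs_polytope 1).
Hypotheses (p_ge2 : (2 <= p)%N) (evenP : even_polygon p P).
Local Notation t0 := (cs_gen P ord0).
Local Notation t1 := (cs_gen P ord_max).
Local Notation r := (t0 * t1).
Local Notation F0 := (base_vertex (cs_gen P)).
Local Notation alpha := (cs_alpha P).

Lemma cs_gen_sqr i : cs_gen P i ^+ 2 = 1.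
Proof. by have [/(_ i)[_]] := (cs_string P).1. Qed.

Lemma ord2P (i : 'I_2) : i = ord0 \/ i = ord_max.
Proof. by case: i => [[|[|//]] ?]; [left|right]; apply: val_inj. Qed.

Lemma polygon_generated : generated [set t0; t1] = setT.
Proof.
have [_ genP _] := (cs_string P).1; apply/seteqP; split=> // g _.
have : parabolic (cs_gen P) [set: _]%SET g by rewrite genP.
apply: (generated_min (generated_subgroup _)) => _ [i _ <-].
by apply: sub_generated; case: (ord2P i) => ->; [left|right].
Qed.

Lemma rotation_order k : r ^+ k = 1 <-> (2 * p %| k)%N.
Proof. by case: evenP. Qed.

Lemma alphaE : alpha = r ^+ p.
Proof. by case: evenP. Qed.

Lemma rotation_alpha : r ^- p = alpha.
Proof.
rewrite -alphaE; apply: involution_inv.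
by have [] := cs_alpha_involution P.
Qed.

Lemma vertex_stab1P g : vertex_stab (cs_gen P) g -> g = 1 \/ g = t1.
Proof.
have t1V := involution_inv (cs_gen_sqr ord_max).
apply: (@generated_min _ _ [set 1; t1]) => [|_ [i i0 <-]]; last first.
  by right; case: (ord2P i) i0 => -> //=; rewrite finset.in_setC finset.in_set1.
split=> [|h k [->|->] [->|->]|h [->|->]]; first by left.
- by left; rewrite mulg1.
- by right; rewrite mul1g.
- by right; rewrite mulg1.
- by left; apply: cs_gen_sqr.
- by left; rewrite invg1.
- by right.
Qed.

Lemma vertex_act_base_stab : vertex_act F0 t1 = F0.
Proof.
have [S1 SM SV] := generated_subgroup
  [set cs_gen P i | i in [set` [set~ ord0]%SET]].
have S_t1 : vertex_stab (cs_gen P) t1.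
  apply: sub_generated; exists ord_max => //=.
  by rewrite finset.in_setC finset.in_set1.
apply: val_inj; apply/seteqP; split=> g /=.
  by case=> h Sh <-; apply: SM.
by move=> Sg; exists (g * t1^-1); [apply: SM => //; apply: SV | rewrite mulgVK].
Qed.

Lemma rotation_stab k : vertex_stab (cs_gen P) (r ^+ k) -> (2 * p %| k)%N.
Proof.
have p2_gt2 : (2 < 2 * p)%N by apply: leq_trans (leq_mul (leqnn 2) p_ge2).
move=> /vertex_stab1P[/rotation_order//|rE].
by have [] := reflection_neq_rotation (cs_gen_sqr _) (cs_gen_sqr _) p2_gt2
  rotation_order (esym rE).
Qed.

(** No nontrivial power of r lies in the stabilizer {1, tau_1} of F_0, so
F_0 r^j determines j modulo 2p; and alpha = r^p. *)
Lemma base_rotation_neq j : (0 < j < p)%N ->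
  vertex_act F0 (r ^- j) <> F0 /\
  vertex_act F0 (r ^- j) <> vertex_act F0 alpha.
Proof.
have small k : (0 < k < 2 * p)%N -> ~ vertex_stab (cs_gen P) (r ^+ k).
  move=> /andP[k_gt0 kp] /rotation_stab/(dvdn_leq k_gt0).
  by rewrite leqNgt kp.
move=> /andP[j_gt0 jp]; split.
  rewrite -{2}(vertex_act1 F0) => /esym/base_vertex_stab.
  rewrite mul1g invgK; apply: small; rewrite j_gt0.
  by rewrite (leq_trans jp) // leq_pmull.
move=> /esym/base_vertex_stab; rewrite alphaE invgK -expgnDr; apply: small.
by rewrite mul2n -addnn ltn_add2l jp addn_gt0 j_gt0 orbT.
Qed.

Lemma vertex_rotation F :
  exists2 k, (k < 2 * p)%N & F = vertex_act F0 (r ^- k).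
Proof.
have [g ->] := vertexP F.
have : generated [set t0; t1] g^-1 by rewrite polygon_generated.
have p2_gt0 : (0 < 2 * p)%N by rewrite muln_gt0 (ltnW p_ge2).
have r2p : r ^+ (2 * p) = 1 by apply/rotation_order.
move=> /(dihedral_normal_form (cs_gen_sqr _) (cs_gen_sqr _) p2_gt0 r2p).
move=> [k [b [kp gE]]]; exists k => //.
rewrite -[g]invgK gE invgM vertex_actM; congr (vertex_act _ _).
case: b {gE} => /=; last by rewrite invg1 vertex_act1.
by rewrite (involution_inv (cs_gen_sqr _)) vertex_act_base_stab.
Qed.

Variable s : nat.
Local Notation T := (twist_group P s).

Lemma twist_bracket_relators :
  bracket_triple p s (twist_diagram (sigma s F0) : T) (twist_polytope s t0)
    (twist_polytope s t1).
Proof.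
set a : T := twist_diagram _; set b : T := twist_polytope s t0.
set c : T := twist_polytope s t1.
have conj_a k :
    a ^ (b * c) ^- k = twist_diagram (sigma s (vertex_act F0 (r ^- k))).
  by rewrite -twist_sigma_conj gmulfV gmulfXn gmulfM.
split.
- by split; rewrite -gmulfXn ?sigma_sqr ?cs_gen_sqr gmulf1.
- have aac : a ^ c = a by rewrite /c twist_sigma_conj vertex_act_base_stab.
  by rewrite /commute conjgC aac.
- rewrite -gmulfM -gmulfXn (_ : r ^+ (2 * p) = 1) ?gmulf1 //.
  exact/rotation_order.
- move=> j /base_rotation_neq[neq neq_alpha]; rewrite conj_a.
  exact/gmulf_commute/sigma_commute.
by rewrite conj_a rotation_alpha -gmulfM -gmulfXn sigma_opp gmulf1.
Qed.

(** Equivariance of x transports every Coxeter relation to one that involves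
the base vertex, where it is one of the relations of the triple. *)
Lemma twist_lift_bracket (G : groupType) (a b c : G) :
    bracket_triple p s a b c ->
  exists h : {hom T -> G},
    [/\ h (twist_diagram (sigma s F0)) = a, h (twist_polytope s t0) = b
      & h (twist_polytope s t1) = c].
Proof.
move=> [[a2 b2 c2] ac rp near opp].
have p_gt0 : (0 < p)%N by apply: leq_trans p_ge2.
have p2_gt2 : (2 < 2 * p)%N by apply: leq_trans (leq_mul (leqnn 2) p_ge2).
have [f [fb fc]] := dihedral_lift (cs_gen_sqr ord0) (cs_gen_sqr ord_max)
  polygon_generated p2_gt2 rotation_order b2 c2 rp.
have fr k : f (r ^- k) = (b * c) ^- k by rewrite gmulfV gmulfXn gmulfM fb fc.
have [x xE] : exists x : vertex (cs_gen P) -> G,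
    forall g, x (vertex_act F0 g) = a ^ f g.
  apply: orbit_conj => i; case: (ord2P i) => -> // _.
  by rewrite fc.
have xf F g : x (vertex_act F g) = x F ^ f g.
  have [h ->] := vertexP F.
  by rewrite -vertex_actM !xE gmulfM conjgM.
have x_base : x F0 = a by rewrite -(vertex_act1 F0) xE gmulf1 conjg1.
have x_sqr F : x F ^+ 2 = 1.
  by have [g ->] := vertexP F; rewrite xE -conjXg a2 conj1g.
have xrel R : diagram_relator s R -> eval_word x R = 1.
  case=> {R} [F|F|F F' neq neq_alpha];
    rewrite eval_wpow ?eval_cat !eval_wletter.
  - exact: x_sqr.
  - have [g ->] := vertexP F; rewrite -vertex_act_alpha xf.
    rewrite (xf (vertex_act F0 _)) x_base -conjMg -conjXg xE.
    by rewrite -rotation_alpha fr opp conj1g.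
  have [g FE] := vertexP F.
  have [E F'E] : exists E, F' = vertex_act E g.
    by exists (vertex_act F' g^-1); rewrite -vertex_actM mulVg vertex_act1.
  have E_neq : E <> F0 by move=> E0; apply: neq; rewrite F'E E0.
  have E_neq_alpha : E <> vertex_act F0 alpha.
    by move=> Ea; apply: neq_alpha; rewrite F'E Ea vertex_act_alpha FE.
  rewrite F'E FE !xf x_base -conjMg -conjXg.
  suff axE : commute a (x E).
    by rewrite (involutions_commuteP a2 (x_sqr E)).2 ?conj1g.
  have [k kp EE] := vertex_rotation E; rewrite EE xE fr.
  have [k_small|k_large|kE] := ltngtP k p; last first.
  - by case: E_neq_alpha; rewrite EE kE rotation_alpha.
  (* F_0 r^(-k) = F_0 r^(2p-k) is the image under tau_1 of F_0 r^(-(2p-k)). *)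
  - have -> : (b * c) ^- k = (b * c) ^+ (2 * p - k).
      by apply: mulg1_eq; rewrite -expgnDr subnKC // ltnW.
    apply: conj_rotation_commute => //; apply: near.
    by rewrite subn_gt0 kp ltn_subLR ?(ltnW kp) // mul2n -addnn ltn_add2r.
  apply: near; rewrite k_small andbT lt0n; apply: contra_notN E_neq => /eqP k0.
  by rewrite EE k0 expg0 invg1 vertex_act1.
have [h [hs ht]] := twist_lift xrel xf.
by exists h; rewrite hs !ht x_base fb fc.
Qed.

End Polygon.

Local Close Scope group_scope.
Local Close Scope classical_set_scope.

Theorem proposition3p3 (p s : nat) (P : cs_polytope 1)
    (hp : (2 <= p)%N) (hs : (2 <= s)%N) (hP : even_polygon p P) :
  @has_presentation 'I_3 (twist_group P s) (twist_gen P s)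
    (bracket_relator 4 (2 * p) (rcons (nseq (p - 2) 4) (2 * s))).
Proof.
have gen0 : twist_gen P s (@Ordinal 3 0 isT) =
    twist_diagram (sigma s (base_vertex (cs_gen P))).
  by rewrite -twist_gen0; congr twist_gen; apply: val_inj.
have gen1 : twist_gen P s (@Ordinal 3 1 isT) = twist_polytope s (cs_gen P ord0).
  by rewrite -twist_genS; congr twist_gen; apply: val_inj.
have gen2 : twist_gen P s (@Ordinal 3 2 isT) =
    twist_polytope s (cs_gen P ord_max).
  by rewrite -twist_genS; congr twist_gen; apply: val_inj.
apply: has_presentation_lift.
- apply/(bracket_relatorsP (twist_gen P s) s hp).
  rewrite gen0 gen1 gen2; exact: twist_bracket_relators.
- exact: twist_generated.
set R := bracket_relator _ _ _.
have /(twist_lift_bracket hp hP) :=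
  (bracket_relatorsP (pgen R) s hp).1 (@eval_relator _ R).
move=> [g [ga gb gc]]; exists g => -[[|[|[|//]]] i_lt].
- by rewrite (bool_irrelevance i_lt isT) gen0 ga.
- by rewrite (bool_irrelevance i_lt isT) gen1 gb.
- by rewrite (bool_irrelevance i_lt isT) gen2 gc.
Qed.
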